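(* Let $\|\cdot\|$ be a norm on $\mathbb{R}^d$ and $\epsilon\ge 0$. Let $\mu$ and $\nu$ be finite positive measures on $\mathbb{R}^d$ with $\mu(\mathbb{R}^d)=\nu(\mathbb{R}^d)$, both absolutely continuous with respect to Lebesgue measure and with bounded supports. Then $D_\epsilon(\mu,\nu)=0$ if and only if $W_\infty(\mu,\nu)\le 2\epsilon$.
   Context: $\Pi(\mu,\nu)$ is the set of measures on $\mathbb{R}^d\times\mathbb{R}^d$ with marginals $\mu$ and $\nu$, and $D_\epsilon(\mu,\nu)=\inf_{\pi\in\Pi(\mu,\nu)}\pi\big(\{(x,x'):\|x-x'\|>2\epsilon\}\big)$. $W_p(\mu,\nu)=\big(\inf_{\pi\in\Pi(\mu,\nu)}\int\|x-x'\|^p\,d\pi\big)^{1/p}$ and $W_\infty(\mu,\nu)=\lim_{p\to\infty}W_p(\mu,\nu)$. *)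

(* Defs.v *)
(* R^d is modelled as [d.-tuple R] with the library's
   product (Borel) sigma-algebra [measure_tuple_display]. *)
From HB Require Import structures.
From mathcomp Require Import all_boot all_order all_algebra.
From mathcomp Require Import all_classical all_reals all_analysis.
Set Implicit Arguments. Unset Strict Implicit. Unset Printing Implicit Defensive.
Import Order.TTheory GRing.Theory Num.Theory.
Local Open Scope classical_set_scope.
Local Open Scope ring_scope.

Definition vzero (R : realType) (d : nat) : d.-tuple R := [tuple (0:R) | i < d].
Definition vadd (R : realType) (d : nat) (x y : d.-tuple R) : d.-tuple R :=
  [tuple tnth x i + tnth y i | i < d].
Definition vscale (R : realType) (d : nat) (a : R) (x : d.-tuple R) : d.-tuple R :=
  [tuple a * tnth x i | i < d].
Definition vsub (R : realType) (d : nat) (x y : d.-tuple R) : d.-tuple R :=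
  [tuple tnth x i - tnth y i | i < d].

Definition is_norm (R : realType) (d : nat) (N : d.-tuple R -> R) : Prop :=
  [/\ (forall x, 0 <= N x),
      (forall x, N x = 0 -> x = vzero R d),
      (forall a x, N (vscale a x) = `|a| * N x) &
      (forall x y, N (vadd x y) <= N x + N y)].

Definition in_box (R : realType) (d : nat) (a b x : d.-tuple R) : Prop :=
  forall i, tnth a i < tnth x i < tnth b i.
Definition box_vol (R : realType) (d : nat) (a b : d.-tuple R) : R :=
  \prod_(i < d) (tnth b i - tnth a i).
Definition lebesgue_null (R : realType) (d : nat) (A : set (d.-tuple R)) : Prop :=
  forall e : R, 0 < e -> exists a b : nat -> d.-tuple R,
    [/\ (forall k i, tnth (a k) i <= tnth (b k) i),
        A `<=` \bigcup_k [set x | in_box (a k) (b k) x] &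
        (\sum_(k <oo) (box_vol (a k) (b k))%:E <= e%:E)%E].

Definition abs_cont_leb (R : realType) (d : nat)
    (mu : {measure set (d.-tuple R) -> \bar R}) : Prop :=
  forall A, measurable A -> lebesgue_null A -> mu A = 0%E.

Definition msupport (R : realType) (d : nat) (N : d.-tuple R -> R)
    (mu : {measure set (d.-tuple R) -> \bar R}) : set (d.-tuple R) :=
  [set x | forall r : R, 0 < r -> (0 < mu [set y | (N (vsub y x) < r)%R])%E].

Definition bounded_support (R : realType) (d : nat) (N : d.-tuple R -> R)
    (mu : {measure set (d.-tuple R) -> \bar R}) : Prop :=
  exists M : R, forall x, msupport N mu x -> N x <= M.

Definition coupling (R : realType) (d : nat)
    (mu nu : {measure set (d.-tuple R) -> \bar R})
    (pi : {measure set (d.-tuple R * d.-tuple R) -> \bar R}) : Prop :=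
  (forall A, measurable A -> pi (A `*` setT) = mu A) /\
  (forall B, measurable B -> pi (setT `*` B) = nu B).

Definition Deps (R : realType) (d : nat) (N : d.-tuple R -> R)
    (mu nu : {measure set (d.-tuple R) -> \bar R}) (eps : R) : \bar R :=
  ereal_inf [set pi [set z | 2 * eps < N (vsub z.1 z.2)] | pi in coupling mu nu].

Definition Wp (R : realType) (d : nat) (N : d.-tuple R -> R)
    (mu nu : {measure set (d.-tuple R) -> \bar R}) (p : R) : \bar R :=
  ((ereal_inf [set (\int[pi]_z ((N (vsub z.1 z.2)) `^ p)%:E)%E
               | pi in coupling mu nu]) `^ p^-1)%E.

Definition Winf (R : realType) (d : nat) (N : d.-tuple R -> R)
    (mu nu : {measure set (d.-tuple R) -> \bar R}) : \bar R :=
  lim (Wp N mu nu p @[p --> +oo%R]).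

(* Main.v *)
Require Import Defs.
From HB Require Import structures.
From mathcomp Require Import all_boot all_order all_algebra.
From mathcomp Require Import all_classical all_reals all_analysis.
From mathcomp Require Import measurable_realfun ring lra.
Import Order.TTheory GRing.Theory Num.Theory.
Import numFieldNormedType.Exports.
Local Open Scope classical_set_scope.
Local Open Scope ring_scope.

(* Let [c] be the infimum of the [t >= 0] with
   [inf_pi pi {|x - x'| > t} = 0].  Then [W_p -> c] as [p -> +oo], and the
   infimum defining [D] vanishes exactly from [c] on, whence the equivalence.
   Both facts rest on the infimum being attained, with value [0], at [t = c].
   If [pi {|x - x'| > t} >= eta > 0] for all couplings then
   [W_p >= eta^(1/p) t], and if [pi {|x - x'| > c} = 0] for some coupling then
   [W_p <= M^(1/p) c], [M] being the total mass.

   Attainment is a compactness property of couplings, obtained by transport to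
   the Cantor space [nat -> bool].  Encode points of R^d by the bits [x_i < q]
   and take limits of the masses of cylinders along an ultrafilter; the limit
   weights on the binary tree are realised by cutting an interval of length [M]
   into nested subintervals and pushing Lebesgue measure forward.  Since the
   marginals of the encoded couplings are constant, those of the limit are the
   encodings of [mu] and [nu], so decoding gives a coupling again; as
   [{|x - x'| > c}] is a countable union of cylinders whose limit mass is [0],
   it is null for that coupling. *)

(** * Cylinders, finitely determined sets and measurability on the Cantor space *)

(* Prefixes are stored in reverse, so that extending a word is a [cons]. *)
Fixpoint prefix (c : nat -> bool) (n : nat) : seq bool :=
  if n is m.+1 then c m :: prefix c m else [::].

Definition cylinder (w : seq bool) : set (nat -> bool) :=
  [set c | prefix c (size w) = w].

Definition cylinders : set (set (nat -> bool)) :=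
  [set A | A = set0 \/ exists w, A = cylinder w].

Definition cantor := g_sigma_algebraType cylinders.
HB.instance Definition _ := Measurable.on cantor.

Lemma size_prefix c n : size (prefix c n) = n.
Proof. by elim: n => //= n ->. Qed.

Lemma eq_prefixP c c' n :
  prefix c n = prefix c' n <-> (forall j, (j < n)%N -> c j = c' j).
Proof.
elim: n => [|n IH] /=; first by split.
split=> [[cn /IH eqc] j|eqc].
  by rewrite ltnS leq_eqVlt => /orP[/eqP ->|/eqc].
by rewrite eqc// (IH.2 _)// => j jn; apply: eqc; exact: ltnW.
Qed.

Lemma cylinder_cons b w : cylinder (b :: w) = cylinder w `&` [set c | c (size w) = b].
Proof.
by apply/seteqP; split => c /=; rewrite /cylinder /=; [case=> -> -> | case=> -> ->].
Qed.

Lemma cylinder_split w : cylinder w = cylinder (false :: w) `|` cylinder (true :: w).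
Proof.
rewrite !cylinder_cons -setIUr; apply/seteqP; split=> [c cw|c []//].
by split=> //=; case: (c _); [right|left].
Qed.

Lemma cylinder_split0 w : cylinder (false :: w) `&` cylinder (true :: w) = set0.
Proof.
rewrite !cylinder_cons; apply/seteqP; split=> // c [[_ /= ->] []] //.
Qed.

Lemma cylinder_sub w w' c : (size w <= size w')%N ->
  cylinder w c -> cylinder w' c -> cylinder w' `<=` cylinder w.
Proof.
move=> ww' cw cw' x xw'; rewrite /cylinder/= -[RHS]cw.
apply/eq_prefixP => j jw; have /eq_prefixP := etrans xw' (esym cw').
by apply; exact: leq_trans ww'.
Qed.

(** Two cylinders are nested or disjoint, so a nonempty intersection is the one with the longer
    word. This makes cylinders a generating pi-system, on which finite measures can be compared. *)
Lemma cylinders_setI : setI_closed cylinders.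
Proof.
suff H w w' : (size w <= size w')%N -> cylinders (cylinder w `&` cylinder w').
  move=> _ _ [->|[w ->]] [->|[w' ->]]; rewrite ?set0I ?setI0; try by left.
  have [/H//|/ltnW/H] := leqP (size w) (size w').
  by rewrite setIC.
move=> ww'; have [->|/set0P[c [cw cw']]] := eqVneq (cylinder w `&` cylinder w') set0.
  by left.
right; exists w'; apply/seteqP; split=> [x []//|x xw']; split => //.
exact: (@cylinder_sub _ w' c).
Qed.

Lemma measurable_cylinder w : measurable (cylinder w : set cantor).
Proof. by apply: sub_sigma_algebra; right; exists w. Qed.

Lemma cylinder_nil : cylinder [::] = setT.
Proof. by apply/seteqP; split. Qed.

(** These are the clopen sets. Agreement of two sequences is symmetric, so membership depends on the
    first [m] bits alone. *)
Definition decided (m : nat) (B : set (nat -> bool)) :=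
  forall c c', (forall j, (j < m)%N -> c j = c' j) -> B c -> B c'.

Lemma decided_bigcup m B : decided m B ->
  B = \bigcup_(w in [set w | exists2 c, B c & prefix c m = w]) cylinder w.
Proof.
move=> dB; apply/seteqP; split=> [c Bc|c [_ [c' Bc' <-]]].
  by exists (prefix c m) => /=; [exists c|rewrite /cylinder/= size_prefix].
rewrite /cylinder/= size_prefix => /eq_prefixP cc'.
by apply: dB Bc' => j /cc'.
Qed.

(** There are only countably many words, so [D] may be arbitrary. *)
Lemma bigcup_words_measurable d (T : measurableType d) (D : set (seq bool))
  (F : seq bool -> set T) : (forall w, measurable (F w)) ->
  measurable (\bigcup_(w in D) F w).
Proof.
move=> mF; rewrite bigcup_mkcond; apply: countable_bigcupT_measurable => // w.
by case: ifP.
Qed.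

Lemma decided_measurable m B : decided m B -> measurable (B : set cantor).
Proof.
move=> /decided_bigcup ->; apply: bigcup_words_measurable => w.
exact: measurable_cylinder.
Qed.

(** A cylinder is a finite intersection of conditions on single bits, and cylinders generate the
    sigma-algebra. *)
Lemma measurable_to_cantor d (T : measurableType d) (f : T -> cantor) :
  (forall k, measurable [set x | f x k]) -> measurable_fun setT f.
Proof.
move=> mf; apply: (@measurability _ _ T cantor setT f cylinders) => // _ [A [->|[w ->]] <-].
  by rewrite preimage_set0 setI0.
rewrite setTI; elim: w => [|b w IH]; first by rewrite cylinder_nil preimage_setT.
rewrite cylinder_cons preimage_setI; apply: measurableI => //.
case: b; first exact: mf.
rewrite [X in measurable X](_ : _ = ~` [set x | f x (size w)]).
  exact: measurableC.
by apply/seteqP; split=> x /=; case: (f x _).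
Qed.

Lemma measurable_bit k : measurable [set c : cantor | c k].
Proof.
apply: (@decided_measurable k.+1) => c c' cc' /=; rewrite cc'//.
Qed.

Lemma pushforward_exists d d' (T : measurableType d) (T' : measurableType d')
    (R : realType) (m : {measure set T -> \bar R}) (f : T -> T') :
  measurable_fun setT f ->
  exists P : {measure set T' -> \bar R}, forall A, P A = m (f @^-1` A).
Proof.
move=> mf.
unshelve eexists; first by unshelve refine (pushforward m f : measure _ _).
by [].
Qed.

(** * Measures on the Cantor space with prescribed cylinder masses *)

Section tree.
Variables (R : realType) (lam : seq bool -> R).
Hypothesis lam_ge0 : forall w, 0 <= lam w.
Hypothesis lam_add : forall w, lam w = lam (false :: w) + lam (true :: w).

(* Word [w] is given the interval [[tree_left w, tree_left w + lam w[]; those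
   of its two extensions split it, [false] to the left. *)
Fixpoint tree_left (w : seq bool) : R :=
  if w is b :: w' then tree_left w' + (if b then lam (false :: w') else 0) else 0.

Fixpoint tree_path (u : R) (n : nat) : seq bool :=
  if n is m.+1 then
    (tree_left (tree_path u m) + lam (false :: tree_path u m) <= u) :: tree_path u m
  else [::].

Definition tree_bits (u : R) : cantor :=
  fun n => tree_left (tree_path u n) + lam (false :: tree_path u n) <= u.

Lemma prefix_tree_bits u n : prefix (tree_bits u) n = tree_path u n.
Proof. by elim: n => //= n ->. Qed.

(** Induction on [w]: a point in the interval of [w] has path [w], so its next bit compares it with
    the cut point of that interval. Intersecting with [[0, lam [::][] matters, since points outside
    it also receive bits. *)
Lemma tree_bits_cylinder w :
  `[0, lam [::][ `&` tree_bits @^-1` (cylinder w) =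
  `[tree_left w, tree_left w + lam w[%classic.
Proof.
elim: w => [|b w IH]; first by rewrite cylinder_nil preimage_setT setIT add0r.
rewrite cylinder_cons preimage_setI setIA IH.
have : `[tree_left w, tree_left w + lam w[%classic `<=` tree_bits @^-1` cylinder w.
  by rewrite -IH; exact: subIsetr.
have := lam_add w; have := lam_ge0 (true :: w); have := lam_ge0 (false :: w).
move=> l0 l1 lw sub; apply/seteqP; split=> u /=.
  move=> [uw]; have := sub _ uw; rewrite /cylinder /= prefix_tree_bits => pw.
  rewrite /tree_bits pw; move: uw; rewrite !in_itv/= => /andP[u1 u2].
  case: b => bu; apply/andP; split; move: bu => //.
  - by move=> _; move: u2; rewrite lw addrA.
  - by rewrite addr0.
  - by move/negbT; rewrite -ltNge addr0.
move=> uw; have uw' : `[tree_left w, tree_left w + lam w[%classic u.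
  move: uw; rewrite /= !in_itv/= lw => /andP[u1 u2]; apply/andP; split.
    by apply: le_trans u1; case: (b); rewrite ?addr0// lerDl.
  apply: (lt_le_trans u2); rewrite -addrA lerD2l; case: (b) => //.
  by rewrite add0r lerDl.
split => //; have := sub _ uw'; rewrite /cylinder /= prefix_tree_bits => pw.
rewrite /tree_bits pw; move: uw; rewrite /= !in_itv/=; case: b => /andP[u1 u2] //.
by apply/negbTE; rewrite -ltNge; move: u2; rewrite addr0.
Qed.

Lemma measurable_tree_path n w : measurable [set u : R | tree_path u n = w].
Proof.
elim: n w => [|n IH] [|b w] /=.
- by rewrite [X in measurable X](_ : _ = setT)//; apply/seteqP; split.
- by rewrite [X in measurable X](_ : _ = set0)//; apply/seteqP; split.
- by rewrite [X in measurable X](_ : _ = set0)//; apply/seteqP; split.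
pose t := tree_left w + lam (false :: w).
rewrite [X in measurable X](_ : _ = [set u : R | tree_path u n = w] `&`
   if b then `[t, +oo[%classic else `]-oo, t[%classic).
  by apply: measurableI => //; case: b.
apply/seteqP; split=> u /=.
  by case=> + pw; rewrite pw => <-; split=> //; case: leP => /= h; rewrite in_itv/= ?h.
move=> [pw]; rewrite pw /t; case: b => /=; rewrite in_itv/= ?andbT => h.
  by rewrite h.
by rewrite leNgt h.
Qed.

Lemma measurable_tree_bits : measurable_fun [set: R] tree_bits.
Proof.
apply: measurable_to_cantor => k.
rewrite [X in measurable X](_ : _ = \bigcup_(w in setT)
   ([set u : R | tree_path u k = w] `&` `[tree_left w + lam (false :: w), +oo[%classic)).
  apply: bigcup_words_measurable => w; apply: measurableI => //.
  exact: measurable_tree_path.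
apply/seteqP; split=> u /=; rewrite /tree_bits.
  by move=> h; exists (tree_path u k) => //; split => //=; rewrite in_itv/= h.
by move=> [w _ [/= ->]]; rewrite in_itv/= andbT.
Qed.

Lemma tree_measure : exists P : {measure set cantor -> \bar R},
  forall w, P (cylinder w) = (lam w)%:E.
Proof.
have mD : measurable (`[0, lam [::][%classic : set (measurableTypeR R)) by [].
have [P HP] := pushforward_exists _ _ _ _ _ (mrestr lebesgue_measure mD)
  _ measurable_tree_bits.
exists P => w; rewrite HP -[LHS]/(lebesgue_measure (_ `&` _)) setIC tree_bits_cylinder.
rewrite lebesgue_measure_itv/= lte_fin ltrDl -EFinD addrAC subrr add0r.
(* The length formula returns 0 on an empty interval, which is the case [lam w = 0]. *)
have := lam_ge0 w; rewrite le_eqVlt => /orP[/eqP <-|->//].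
by rewrite ltxx.
Qed.
End tree.

(** * Ultrafilter limits of measures on the Cantor space *)

Lemma fmap_ultra (S T : Type) (f : S -> T) (U : set_system S) :
  UltraFilter U -> UltraFilter (f x @[x --> U]).
Proof.
move=> UU; split; first exact: fmap_proper_filter.
move=> G GG UG; apply/seteqP; split=> A; last exact: UG.
(* Either [A] or its complement has its preimage in [U]; the second would put two disjoint sets in
   [G]. *)
have [//|UA' GA] := in_ultra_setVsetC (f @^-1` A) UU.
have GA' : G (~` A) by exact: (UG (~` A) UA').
by exfalso; apply: (@filter_not_empty _ G); rewrite -(setICr A); exact: filterI.
Qed.

Lemma ultra_bounded_cvg (R : realType) (U : set_system nat) (f : nat -> R) (a b : R) :
  UltraFilter U -> (forall n, a <= f n <= b) -> exists2 l : R, a <= l <= b & f x @[x --> U] --> l.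
Proof.
move=> UU fab.
have := @segment_compact R a b; rewrite compact_ultra => /(_ _ (@fmap_ultra _ _ f _ UU)).
case=> [|l [lab fl]].
  have fT : f @^-1` `[a, b] = setT by apply/seteqP; split=> // n _ /=; rewrite in_itv/=.
  have UT : U setT by exact: filterT.
  by rewrite -fT in UT.
exists l; last exact: fl.
by have : l \in `[a, b] := lab; rewrite in_itv.
Qed.

Lemma measure_cylinder_split (R : realType) (Q : {measure set cantor -> \bar R}) w
    (B : set cantor) : measurable B ->
  Q (cylinder w `&` B) = (Q (cylinder (false :: w) `&` B) + Q (cylinder (true :: w) `&` B))%E.
Proof.
move=> mB; rewrite {1}cylinder_split setIUl measureU//.
- by apply: measurableI => //; exact: measurable_cylinder.
- by apply: measurableI => //; exact: measurable_cylinder.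
- by rewrite setIACA cylinder_split0 set0I.
Qed.

(** Along an ultrafilter the masses of all cylinders converge at once, with no diagonal extraction.
    Additivity passes to the limit, so the limit weights come from a measure, and a decided set is a
    finite disjoint union of cylinders. *)
Lemma cantor_measure_compact (R : realType) (Q : nat -> {measure set cantor -> \bar R})
    (M : R) (U : set_system nat) : UltraFilter U ->
  (forall n, Q n setT = M%:E) ->
  exists P : {measure set cantor -> \bar R},
    forall m B, decided m B -> Q n B @[n --> U] --> P B.
Proof.
move=> UU QM.
have Qle n (B : set cantor) : measurable B -> (Q n B <= M%:E)%E.
  by move=> mB; rewrite -(QM n); apply: le_measure; rewrite ?inE.
have Qfin n (B : set cantor) : measurable B -> Q n B \is a fin_num.
  by move=> mB; rewrite ge0_fin_numE ?measure_ge0//; apply: le_lt_trans (Qle _ _ mB) (ltry _).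
have mcyl w : measurable (cylinder w : set cantor) := measurable_cylinder w.
have limQ w : exists l : R, 0 <= l /\ fine (Q n (cylinder w)) @[n --> U] --> l.
  have Q0M n : 0 <= fine (Q n (cylinder w)) <= M.
    by rewrite fine_ge0 ?measure_ge0//= -lee_fin fineK ?Qle// Qfin.
  have [l /andP[l0 _] Ql] := ultra_bounded_cvg _ _ _ _ _ UU Q0M.
  by exists l.
have [lam lamP] := choice limQ.
have lam_ge0 w : 0 <= lam w by have [] := lamP w.
have lam_add w : lam w = lam (false :: w) + lam (true :: w).
  have [_ Q0] := lamP (false :: w); have [_ Q1] := lamP (true :: w).
  have [_ Qw] := lamP w; apply: (cvg_unique _ Qw) => //.
  rewrite (_ : (fun n => _) = (fun n => fine (Q n (cylinder (false :: w)))) \+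
     (fun n => fine (Q n (cylinder (true :: w))))); first exact: cvgD.
  apply/funext => n /=; rewrite -fineD ?Qfin//; congr fine.
  by have := measure_cylinder_split _ (Q n) w _ measurableT; rewrite !setIT.
have [P HP] := tree_measure _ _ lam_ge0 lam_add.
exists P => m B dB.
have mB := decided_measurable _ _ dB.
have Qcyl w : Q n (cylinder w) @[n --> U] --> P (cylinder w).
  rewrite HP; apply/fine_cvgP; split; last by have [] := lamP w.
  by apply: filterS filterT => n _; exact: Qfin.
(* Split [w] until it decides [B]; [k] is the number of missing bits. *)
suff H k w : (m <= size w + k)%N ->
    Q n (cylinder w `&` B) @[n --> U] --> P (cylinder w `&` B).
  by have := H m [::] (leqnn _); rewrite cylinder_nil !setTI.
elim: k w => [|k IH] w mw.
  rewrite addn0 in mw.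
  have [->|/set0P[c [cw Bc]]] := eqVneq (cylinder w `&` B) set0.
    by rewrite measure0; under eq_fun do rewrite measure0; exact: cvg_cst.
  rewrite (_ : cylinder w `&` B = cylinder w); first exact: Qcyl.
  apply/seteqP; split=> [x []//|x xw]; split=> //.
  apply: dB Bc => j jm.
  have /eq_prefixP := etrans cw (esym xw); apply; exact: leq_trans mw.
rewrite measure_cylinder_split//.
under eq_fun do rewrite measure_cylinder_split//.
have fP b : P (cylinder (b :: w) `&` B) \is a fin_num.
  rewrite ge0_fin_numE ?measure_ge0//.
  apply: (@le_lt_trans _ _ (P (cylinder (b :: w)))); last by rewrite HP ltry.
  by apply: le_measure; rewrite ?inE//; exact: measurableI.
apply: cvgeD; first exact: fin_num_adde_defl.
- by apply: IH; rewrite /= addSnnS.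
- by apply: IH; rewrite /= addSnnS.
Qed.

(** * Images of limit measures under selection of bits *)

Definition reindex (h : nat -> nat) (c : cantor) : cantor := fun k => c (h k).

Lemma measurable_reindex h : measurable_fun setT (reindex h).
Proof. by apply: measurable_to_cantor => k; exact: measurable_bit. Qed.

Lemma decided_reindex h w : exists m, decided m (reindex h @^-1` cylinder w).
Proof.
(* Only the bits [h j] with [j < size w] are read; the successor makes the bound strict. *)
exists (\max_(j < size w) (h j).+1) => c c' cc' /=; rewrite /cylinder/= => {2}<-.
apply/eq_prefixP => j jw; rewrite /reindex cc'//.
by apply: (@leq_bigmax_cond _ predT (fun i : 'I_(size w) => (h i).+1) (Ordinal jw)).
Qed.

(** The preimage of a cylinder is decided, so its limit mass is the limit of a constant sequence.
    Agreement on cylinders then extends to all measurable sets by uniqueness of finite measures on a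
    pi-system. *)
Lemma cantor_limit_reindex (R : realType) (Q : nat -> {measure set cantor -> \bar R})
    (U : set_system nat) (P m : {measure set cantor -> \bar R}) h :
  ProperFilter U ->
  (forall k B, decided k B -> Q n B @[n --> U] --> P B) ->
  (m setT < +oo)%E ->
  (forall n w, Q n (reindex h @^-1` cylinder w) = m (cylinder w)) ->
  forall A : set cantor, measurable A -> P (reindex h @^-1` A) = m A.
Proof.
move=> UU QP mfin Qm A mA.
have [P1 HP1] := pushforward_exists _ _ _ _ _ P _ (measurable_reindex h).
have Pm w : P1 (cylinder w) = m (cylinder w).
  rewrite HP1; have [k dk] := decided_reindex h w.
  have := QP _ _ dk; rewrite (_ : (fun n => _) = fun=> m (cylinder w)); last exact/funext.
  by move=> mP; apply: (cvg_unique _ mP) => //; exact: cvg_cst.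
rewrite -HP1; apply: (@g_sigma_algebra_measure_unique _ R cantor cylinders _ (fun=> setT)) => //.
- by move=> B HB; exact: sub_sigma_algebra.
- by move=> _; right; exists [::]; rewrite cylinder_nil.
- by rewrite bigcup_const//; exists 0%N.
- exact: cylinders_setI.
- by move=> B [->|[w ->]]; rewrite ?measure0.
- by move=> _; rewrite -cylinder_nil Pm cylinder_nil.
Qed.

(** * Coding points and pairs of points by bits *)

Section coding.
Variables (R : realType) (d : nat).

(** The bits list the rational upper cuts of all coordinates; an index that codes no pair carries
    the constant bit [false]. *)
Definition encode (x : d.-tuple R) : cantor := fun k =>
  if unpickle k is Some iq then tnth x (iq : 'I_d * rat).1 < ratr iq.2 else false.

(* Contributes [q] to the infimum of the [q] with [x_i < q], or nothing ([+oo]). *)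
Definition upper_bit (c : cantor) (i : 'I_d) (k : nat) : \bar R :=
  if c k then
    if unpickle k is Some iq then
      if (iq : 'I_d * rat).1 == i then (ratr iq.2)%:E else +oo%E
    else +oo%E
  else +oo%E.

(** A coordinate is recovered as the infimum of the rationals above it. On a sequence that is not a
    code the infimum may be infinite, and [fine] then returns 0. *)
Definition decode (c : cantor) : d.-tuple R :=
  [tuple fine (einfs (upper_bit c i) 0) | i < d].

Lemma encodeE x i q : encode x (pickle (i, q)) = (tnth x i < ratr q).
Proof. by rewrite /encode pickleK. Qed.

Lemma encodeK : cancel encode decode.
Proof.
move=> x; apply: eq_from_tnth => i; rewrite tnth_mktuple.
suff -> : einfs (upper_bit (encode x) i) 0 = (tnth x i)%:E by [].
apply/eqP; rewrite eq_le; apply/andP; split.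
  apply/lee_addgt0Pr => e e0.
  have xe : tnth x i < tnth x i + e by rewrite ltrDl.
  have [q] := rat_in_itvoo xe; rewrite in_itv/= => /andP[xq qe].
  apply: (@le_trans _ _ (ratr q)%:E); last by rewrite -EFinD lee_fin ltW.
  apply: ereal_inf_lbound; exists (pickle (i, q)) => //.
  by rewrite /upper_bit encodeE xq pickleK/= eqxx.
apply: le_ereal_inf_tmp => _ [k _ <-]; rewrite /upper_bit /encode.
case: unpickle => [[j q]|]; last by rewrite leey.
case: ifP => [xq|_]; last by rewrite leey.
by rewrite /=; case: eqP => [<-|_]; rewrite ?leey// lee_fin ltW.
Qed.

Lemma measurable_encode : measurable_fun setT encode.
Proof.
apply: measurable_to_cantor => k; rewrite /encode.
case: unpickle => [[i q]|] /=; last first.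
  by rewrite [X in measurable X](_ : _ = set0)//; apply/seteqP; split.
rewrite -[X in measurable X]setTI.
have := measurable_tnth (i : 'I_d) measurableT (measurable_itv `]-oo, (ratr q : R)[).
congr (measurable (_ `&` _)); apply/seteqP; split=> x /=; by rewrite in_itv.
Qed.

Lemma measurable_decode : measurable_fun setT decode.
Proof.
apply/measurable_fun_tnthP => i.
have mi : @measurable_fun _ _ cantor (\bar R) setT (fun c => einfs (upper_bit c i) 0).
  apply: measurable_fun_einfs => k; rewrite /upper_bit.
  apply: measurable_fun_ifT; [|exact: measurable_cst|exact: measurable_cst].
  apply: (measurable_fun_bool true).
  by rewrite setTI; exact: measurable_bit.
have := measurableT_comp (@fine_measurable R _ measurableT) mi.
by congr measurable_fun; apply/funext => c /=; rewrite tnth_mktuple.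
Qed.

(** Choose for each coordinate a rational on either side of it within [e]. The bits of these
    finitely many rationals confine [y] to the box they span. *)
Lemma encode_close x (e : R) : 0 < e -> exists n, forall y,
  (forall k, (k < n)%N -> encode y k = encode x k) ->
  forall i, `|tnth y i - tnth x i| <= e.
Proof.
move=> e0.
have H i : exists qs : rat * rat, tnth x i - e < ratr qs.1 < tnth x i /\
    tnth x i < ratr qs.2 < tnth x i + e.
  have xe : tnth x i < tnth x i + e by rewrite ltrDl.
  have xe' : tnth x i - e < tnth x i by rewrite gtrBl.
  have [q] := rat_in_itvoo xe; rewrite in_itv/= => q2.
  have [q'] := rat_in_itvoo xe'; rewrite in_itv/= => q1.
  by exists (q', q).
have [qs Hqs] := choice H.
pose b i := maxn (pickle (i, (qs i).1)).+1 (pickle (i, (qs i).2)).+1.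
exists (\max_i b i)%N => y xy i.
have bi : (b i <= \max_i b i)%N by exact: leq_bigmax.
have [/andP[q1 q2] /andP[q3 q4]] := Hqs i.
have := xy (pickle (i, (qs i).1)); rewrite !encodeE (leq_trans _ bi) ?leq_maxl//.
move=> /(_ isT); rewrite [RHS]ltNge (ltW q2)/= => /negbT; rewrite -leNgt => y1.
have := xy (pickle (i, (qs i).2)); rewrite !encodeE (leq_trans _ bi) ?leq_maxr//.
move=> /(_ isT); rewrite q3 => y2.
rewrite ler_norml; apply/andP; split; lra.
Qed.

(** Placing a pair in the even and odd bits lets couplings live on a single Cantor space, with
    marginals given by [reindex]. *)
Definition interleave (a b : cantor) : cantor :=
  fun k => if odd k then b k./2 else a k./2.

Definition encode2 (z : d.-tuple R * d.-tuple R) : cantor :=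
  interleave (encode z.1) (encode z.2).

Definition evens := reindex double.
Definition odds := reindex (fun k => k.*2.+1).

Definition decode2 (c : cantor) : d.-tuple R * d.-tuple R :=
  (decode (evens c), decode (odds c)).

Lemma evens_encode2 z : evens (encode2 z) = encode z.1.
Proof. by apply/funext => k; rewrite /evens /reindex /encode2 /interleave odd_double doubleK. Qed.

Lemma odds_encode2 z : odds (encode2 z) = encode z.2.
Proof.
by apply/funext => k; rewrite /odds /reindex /encode2 /interleave/= odd_double/= uphalf_double.
Qed.

Lemma interleave_split c : interleave (evens c) (odds c) = c.
Proof.
apply/funext => k; rewrite /interleave /evens /odds /reindex -[in RHS](odd_double_half k).
by case: ifP => _.
Qed.

Lemma measurable_encode2 : measurable_fun setT encode2.
Proof.
apply: measurable_to_cantor => k; rewrite /encode2 /interleave.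
have H (f : d.-tuple R * d.-tuple R -> d.-tuple R) j : measurable_fun setT f ->
    measurable [set z | encode (f z) j].
  move=> mf; have := measurableT_comp measurable_encode mf.
  by move=> /(_ measurableT _ (measurable_bit j)); rewrite setTI.
by case: odd; apply: H.
Qed.

Lemma measurable_decode2 : measurable_fun setT decode2.
Proof.
apply: measurable_fun_pair; apply: measurableT_comp; [exact: measurable_decode|..].
- exact: measurable_reindex.
- exact: measurable_decode.
- exact: measurable_reindex.
Qed.

End coding.

(** * Semicontinuity and measurability of the cost *)

Section norm.
Variables (R : realType) (d : nat) (N : d.-tuple R -> R).
Hypothesis normN : is_norm N.

Local Notation cost z := (N (vsub z.1 z.2)).

Lemma norm_coordinates : exists L : R, 0 <= L /\
  forall (e : R) v, 0 <= e -> (forall i, `|tnth v i| <= e) -> N v <= L * e.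
Proof.
have [N0 _ NZ ND] := normN.
pose b (i : 'I_d) : d.-tuple R := [tuple (j == i)%:R | j < d].
pose K := \sum_i N (b i); exists (d%:R * K).
have K0 : 0 <= K by exact: sumr_ge0.
split=> [|e v e0 ve]; first exact: mulr_ge0.
pose t k : d.-tuple R := [tuple if (i < k)%N then tnth v i else 0 | i < d].
have -> : v = t d by apply: eq_from_tnth => i; rewrite tnth_mktuple ltn_ord.
(* Build [v] one coordinate at a time; each new term has norm at most [e * N (b i)], hence at most
   [K * e]. *)
suff : forall k, (k <= d)%N -> N (t k) <= k%:R * K * e by apply.
elim=> [_|k IH kd].
  have -> : t 0%N = vscale 0 v.
    by apply: eq_from_tnth => i; rewrite !tnth_mktuple mul0r.
  by rewrite NZ normr0 !mul0r.
pose i := Ordinal kd.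
have -> : t k.+1 = vadd (t k) (vscale (tnth v i) (b i)).
  apply: eq_from_tnth => j; rewrite !tnth_mktuple ltnS leq_eqVlt.
  have [->|ji] := eqVneq j i; first by rewrite eqxx ltnn add0r mulr1.
  rewrite mulr0 addr0; suff /negbTE -> : (j : nat) != k by [].
  by apply: contra ji => /eqP jk; apply/eqP/val_inj.
apply: le_trans (ND _ _) _; rewrite -natr1 !mulrDl mul1r lerD ?IH// 1?ltnW//.
rewrite NZ mulrC; apply: ler_pM => //.
by rewrite /K (bigD1 i)//= lerDl sumr_ge0.
Qed.

Lemma cost_locally_gt (t : R) z : t < cost z -> exists2 e : R, 0 < e &
  forall z' : d.-tuple R * d.-tuple R, (forall i, `|tnth z'.1 i - tnth z.1 i| <= e) ->
    (forall i, `|tnth z'.2 i - tnth z.2 i| <= e) -> t + e < cost z'.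
Proof.
have [N0 _ NZ ND] := normN; have [L [L0 HL]] := norm_coordinates => tz.
(* Moving both points by [e] per coordinate lowers the cost by at most [2 * L * e]. With the margin
   [e] this totals [(2 * L + 1) * e], half of the gap [cost z - t]. *)
pose e := (cost z - t) / (2 * (2 * L + 1)).
have L1 : 0 < 2 * (2 * L + 1) by apply: mulr_gt0 => //; lra.
have e0 : 0 < e by rewrite divr_gt0// subr_gt0.
exists e => // z' z1 z2.
have : cost z <= cost z' + L * (2 * e).
  have -> : vsub z.1 z.2 = vadd (vsub z'.1 z'.2) (vsub (vsub z.1 z'.1) (vsub z.2 z'.2)).
    by apply: eq_from_tnth => j; rewrite !tnth_mktuple; ring.
  apply: le_trans (ND _ _) _; rewrite lerD2l; apply: HL; first by rewrite mulr_ge0// ltW.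
  move=> i; rewrite !tnth_mktuple; apply: le_trans (ler_normB _ _) _.
  by rewrite mulr_natl mulr2n; apply: lerD; rewrite distrC.
have : e * (2 * (2 * L + 1)) = cost z - t by rewrite divfK// gt_eqF.
by nra.
Qed.

(** Among codes the set of costs above [t] is open. The margin [e] later absorbs thresholds that
    only decrease to the desired one. *)
Lemma cost_decided_gt (t : R) z : t < cost z -> exists m (e : R), 0 < e /\
  forall z', (forall k, (k < m)%N -> encode2 R d z' k = encode2 R d z k) ->
    t + e < cost z'.
Proof.
move=> /cost_locally_gt [e e0 He].
have [n1 H1] := encode_close _ _ z.1 _ e0; have [n2 H2] := encode_close _ _ z.2 _ e0.
(* Each point occupies every other bit, hence the doubling. *)
exists (maxn n1 n2).*2, e; split=> // z' zz'; apply: He.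
  apply: H1 => k kn; have := zz' k.*2.
  rewrite ltn_double (leq_trans kn) ?leq_maxl// => /(_ isT).
  by move: (congr1 (@^~ k) (evens_encode2 _ _ z)) (congr1 (@^~ k) (evens_encode2 _ _ z')) => <- <-.
apply: H2 => k kn; have := zz' k.*2.+1.
rewrite -doubleS leq_double (leq_trans kn) ?leq_maxr// => /(_ isT).
by move: (congr1 (@^~ k) (odds_encode2 _ _ z)) (congr1 (@^~ k) (odds_encode2 _ _ z')) => <- <-.
Qed.

Lemma measurable_cost_gt (t : R) : measurable [set z | t < cost z].
Proof.
pose D := [set w | encode2 R d @^-1` cylinder w `<=` [set z | t < cost z]].
rewrite [X in measurable X](_ : _ = \bigcup_(w in D) (encode2 R d @^-1` cylinder w)).
  apply: bigcup_words_measurable => w; rewrite -[X in measurable X]setTI.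
  by apply: measurable_encode2 => //; exact: measurable_cylinder.
apply/seteqP; split=> [z tz|z [w Dw]]; last exact: Dw.
have [m [e [e0 He]]] := cost_decided_gt _ _ tz.
exists (prefix (encode2 R d z) m); last by rewrite /= /cylinder/= size_prefix.
move=> z'; rewrite /= /cylinder/= size_prefix => /eq_prefixP /He.
by apply: lt_trans; rewrite ltrDl.
Qed.

Lemma measurable_cost : measurable_fun setT (fun z : d.-tuple R * d.-tuple R => cost z).
Proof.
apply: (measurability _ (RGenOInfty.measurableE R)) => // _ [_ [t ->] <-].
rewrite setTI; have := measurable_cost_gt t; congr measurable.
by apply/seteqP; split=> z /=; rewrite in_itv/= andbT.
Qed.

End norm.

(** * Attainment of the infimum over couplings *)

Section coupling.
Variables (R : realType) (d : nat) (N : d.-tuple R -> R).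
Variables (mu nu : {measure set (d.-tuple R) -> \bar R}).
Hypothesis normN : is_norm N.
Hypothesis mu_fin : (mu setT < +oo)%E.
Hypothesis nu_fin : (nu setT < +oo)%E.

Local Notation cost z := (N (vsub z.1 z.2)).

(** [Deps] at [eps] is the case [t = 2 * eps]. *)
Definition excess (t : R) : \bar R :=
  ereal_inf [set pi [set z | t < cost z] | pi in coupling mu nu].

Lemma excess_attained (s : R) : (forall t, s < t -> excess t = 0%E) ->
  exists2 pi, coupling mu nu pi & pi [set z | s < cost z] = 0%E.
Proof.
move=> excess0.
have H (n : nat) : exists pi, coupling mu nu pi /\
    (pi [set z | (s + n.+1%:R^-1 < cost z)%R] < (n.+1%:R^-1)%:E)%E.
  have : (excess (s + n.+1%:R^-1) < (n.+1%:R^-1)%:E)%E.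
    by rewrite excess0 ?ltrDl// lte_fin.
  by move=> /ereal_inf_lt [_ [pi pic <-]] ?; exists pi.
have [pi_ Hpi] := choice H.
have [Q HQ] := choice (fun n => pushforward_exists _ _ _ _ _ (pi_ n) _ (measurable_encode2 R d)).
have [U [UU oU]] := ultraFilterLemma (_ : ProperFilter \oo).
have QT n : Q n setT = (fine (mu setT))%:E.
  rewrite HQ preimage_setT -setXTT; have [[pimu _] _] := Hpi n.
  by rewrite pimu// fineK// ge0_fin_numE.
have [P QP] := cantor_measure_compact _ _ _ _ UU QT.
have [muE HmuE] := pushforward_exists _ _ _ _ _ mu _ (measurable_encode R d).
have [nuE HnuE] := pushforward_exists _ _ _ _ _ nu _ (measurable_encode R d).
have menc A : measurable A -> measurable (encode R d @^-1` A).
  by move=> mA; rewrite -[X in measurable X]setTI; exact: measurable_encode.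
have mdec A : measurable A -> measurable (decode R d @^-1` A).
  by move=> mA; rewrite -[X in measurable X]setTI; exact: measurable_decode.
have Pmu (A : set cantor) : measurable A -> P (evens @^-1` A) = mu (encode R d @^-1` A).
  move=> mA; rewrite -HmuE.
  apply: (cantor_limit_reindex _ Q U P muE double _ QP) mA => [|n w].
    by rewrite HmuE preimage_setT.
  rewrite HQ HmuE; have [[pimu _] _] := Hpi n.
  rewrite -pimu; last by apply: menc; exact: measurable_cylinder.
  congr (pi_ n _); apply/seteqP; split=> z /=.
    by rewrite -/evens evens_encode2.
  by rewrite -/evens evens_encode2 => -[].
have Pnu (A : set cantor) : measurable A -> P (odds @^-1` A) = nu (encode R d @^-1` A).
  move=> mA; rewrite -HnuE.
  apply: (cantor_limit_reindex _ Q U P nuE (fun k => k.*2.+1) _ QP) mA => [|n w].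
    by rewrite HnuE preimage_setT.
  rewrite HQ HnuE; have [[_ pinu] _] := Hpi n.
  rewrite -pinu; last by apply: menc; exact: measurable_cylinder.
  congr (pi_ n _); apply/seteqP; split=> z /=.
    by rewrite -/odds odds_encode2.
  by rewrite -/odds odds_encode2 => -[].
have [pi HP] := pushforward_exists _ _ _ _ _ P _ (measurable_decode2 R d).
have encodeKset (A : set (d.-tuple R)) : encode R d @^-1` (decode R d @^-1` A) = A.
  by apply/seteqP; split=> x /=; rewrite encodeK.
exists pi.
  (* The marginals of [P] are known as images under [encode]; since [decode] inverts [encode],
     decoding them gives back [mu] and [nu]. *)
  split=> A mA; rewrite HP.
    rewrite -[in RHS](encodeKset A) -Pmu; last exact: mdec.
    by congr (P _); apply/seteqP; split=> c /=; [case|].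
  rewrite -[in RHS](encodeKset A) -Pnu; last exact: mdec.
  by congr (P _); apply/seteqP; split=> c /=; [case|].
(* The marginals of [P] live on codes, so almost every [c] satisfies
   [encode2 (decode2 c) = c]. *)
pose bad k := [set c : cantor | encode R d (decode R d c) k != c k].
have mbad k : measurable (bad k).
  have m1 : measurable [set c : cantor | encode R d (decode R d c) k].
    have := measurableT_comp (measurable_encode R d) (measurable_decode R d).
    by move=> /(_ measurableT _ (measurable_bit k)); rewrite setTI.
  have m2 := measurable_bit k.
  rewrite (_ : bad k = ([set c : cantor | encode R d (decode R d c) k] `\` [set c : cantor | c k])
     `|` ([set c : cantor | c k] `\` [set c : cantor | encode R d (decode R d c) k])).
    by apply: measurableU; exact: measurableD.
  apply/seteqP; split=> c; rewrite /bad/=.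
    by case: (encode _ _ _ _); case: (c k) => // _; [left|right].
  by case: (encode _ _ _ _); case: (c k) => // -[[]|[]].
have enc_bad k : encode R d @^-1` bad k = set0.
  by apply/seteqP; split=> x //=; rewrite /bad/= encodeK eqxx.
pose D := [set w | P (cylinder w) = 0%E].
have negl (D' : set (seq bool)) (F : seq bool -> set cantor) :
    (forall w, D' w -> P.-negligible (F w)) -> P.-negligible (\bigcup_(w in D') F w).
  move=> HF; pose G k := if unpickle k is Some w then
     (if w \in D' then F w else set0) else set0.
  apply: (@negligibleS _ _ _ _ (\bigcup_k G k)).
    move=> c [w Dw Fw]; exists (pickle w) => //.
    by rewrite /G pickleK mem_set.
  apply: negligible_bigcup => k; rewrite /G; case: unpickle => [w|]; last exact: negligible_set0.
  case: ifPn => [/set_mem /HF//|_]; exact: negligible_set0.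
have mdec2 : measurable (decode2 R d @^-1` [set z | s < cost z]).
  by rewrite -[X in measurable X]setTI; apply: measurable_decode2 => //;
    exact: measurable_cost_gt.
rewrite HP; apply/negligibleP => //.
(* A sequence decoding to a cost above [s] either is not a code in one of its halves, or is a code
   and then lies in a cylinder of [P]-mass 0. *)
pose Z : set cantor := (\bigcup_(w in D) cylinder w) `|`
   ((\bigcup_k (evens @^-1` bad k)) `|` (\bigcup_k (odds @^-1` bad k))).
apply: (@negligibleS _ cantor _ P Z).
  move=> c /= sc.
  have [[k kbad]|evenOK] := pselect (exists k, bad k (evens c)).
    by right; left; exists k.
  have [[k kbad]|oddOK] := pselect (exists k, bad k (odds c)).
    by right; right; exists k.
  left.
  have decK : encode2 R d (decode2 R d c) = c.
    rewrite -[RHS]interleave_split /encode2/=; congr interleave; apply/funext => k.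
      by apply: contra_notP evenOK => /eqP; exists k.
    by apply: contra_notP oddOK => /eqP; exists k.
  have [m [e [e0 He]]] := cost_decided_gt _ _ _ normN s (decode2 R d c) sc.
  exists (prefix c m); last by rewrite /cylinder/= size_prefix.
  have dm : decided m (cylinder (prefix c m)).
    move=> c1 c2 c12; rewrite /cylinder/= size_prefix => <-.
    by apply/eq_prefixP => j jm; rewrite c12.
  have QPm := QP _ _ dm.
  (* Once [n.+1%:R^-1 < e], the pairs whose code lies in this cylinder have cost above
     [s + n.+1%:R^-1], so its mass under [Q n] is below [n.+1%:R^-1]. *)
  apply: (cvg_unique _ QPm) => //.
  have inv0 : (n.+1%:R^-1 : R)%:E @[n --> U] --> 0%E.
    have : (n.+1%:R^-1 : R)%:E @[n --> \oo] --> 0%E.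
      by apply: cvg_EFin; [exact: nearW|exact: cvg_harmonic].
    exact: cvg_trans (cvg_app _ oU).
  apply: (squeeze_cvge _ (cvg_cst 0%E) inv0).
  have : \forall n \near \oo, (n.+1%:R^-1 < e)%R.
    exact: (near_infty_natSinv_lt (PosNum e0)).
  move=> /oU; apply: filterS => n /= ne.
  rewrite measure_ge0/= HQ; have [_ Hn] := Hpi n; apply: le_trans (ltW Hn).
  apply: le_measure; rewrite ?inE//.
  - rewrite -[X in measurable X]setTI; apply: measurable_encode2 => //.
    exact: measurable_cylinder.
  - exact: measurable_cost_gt.
  move=> z; rewrite /= /cylinder/= size_prefix => /eq_prefixP zc.
  apply: lt_trans (He z _); first by rewrite ltrD2l.
  by move=> k km; rewrite zc// decK.
apply: negligibleU.
  by apply: negl => w Dw; apply/negligibleP => //; exact: measurable_cylinder.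
have mre h k : measurable (reindex h @^-1` bad k).
  by rewrite -[X in measurable X]setTI; exact: measurable_reindex.
apply: negligibleU; apply: negligible_bigcup => k; apply/negligibleP; try exact: mre.
  by have := Pmu _ (mbad k); rewrite enc_bad measure0.
by have := Pnu _ (mbad k); rewrite enc_bad measure0.
Qed.

End coupling.

(** * Behaviour of [Wp] for large exponents *)

Lemma powR_inv_cvg1 (R : realType) (K : R) : 0 < K ->
  K `^ p^-1 @[p --> +oo] --> (1 : R).
Proof.
move=> K0; rewrite /powR gt_eqF//.
have inv0 : (p^-1 : R) @[p --> +oo] --> (0 : R).
  have /gtr0_cvgV0 H : \forall p \near +oo%R, 0 < (p : R) by exact: nbhs_pinfty_gt.
  by apply/H; exact: cvg_id.
have lnK0 : p^-1 * ln K @[p --> +oo] --> (0 : R).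
  by rewrite -[X in _ --> X](mul0r (ln K)); exact: cvgMr_tmp.
rewrite -(@expR0 R); exact: (continuous_cvg _ (@continuous_expR R 0) lnK0).
Qed.

Section wasserstein.
Variables (R : realType) (d : nat) (N : d.-tuple R -> R).
Variables (mu nu : {measure set (d.-tuple R) -> \bar R}).
Hypothesis normN : is_norm N.

Local Notation cost z := (N (vsub z.1 z.2)).
Local Notation W := (Wp N mu nu).
Local Notation excess := (excess R d N mu nu).

Lemma measurable_cost_powR (p : R) :
  measurable_fun setT (fun z : d.-tuple R * d.-tuple R => ((cost z) `^ p)%:E).
Proof.
apply/measurable_EFinP.
exact: (measurableT_comp (measurable_powR p) (measurable_cost _ _ _ normN)).
Qed.

Lemma Wp_le (pi : {measure set (d.-tuple R * d.-tuple R) -> \bar R}) (s p M : R) :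
  coupling mu nu pi -> pi [set z | s < cost z] = 0%E -> 0 <= s -> 0 < p ->
  mu setT = M%:E -> (W p <= (M `^ p^-1 * s)%:E)%E.
Proof.
move=> cpi pi0 s0 p0 muM.
have M0 : 0 <= M by rewrite -lee_fin -muM measure_ge0.
have piM : pi setT = M%:E by rewrite -setXTT cpi.1.
(* As a [p]-th root, the bound reduces to a comparison of integrals, by monotonicity of the root. *)
have -> : (M `^ p^-1 * s)%:E = (((s `^ p * M)%:E) `^ p^-1)%E.
  by rewrite poweR_EFin powRM ?powR_ge0// -powRrM mulfV ?gt_eqF// powRr1// mulrC.
have int_ge0 (m : {measure set (d.-tuple R * d.-tuple R) -> \bar R}) :
    (0 <= \int[m]_z ((cost z) `^ p)%:E)%E.
  by apply: integral_ge0 => z _; rewrite lee_fin powR_ge0.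
apply: gt0_ler_poweR; first by rewrite invr_ge0 ltW.
- rewrite in_itv/= leey andbT.
  by apply: (@le_ereal_inf_tmp R _ 0%E) => _ [m _ <-]; exact: int_ge0.
- by rewrite in_itv/= leey andbT lee_fin mulr_ge0 ?powR_ge0.
apply: ge_ereal_inf; exists (\int[pi]_z ((cost z) `^ p)%:E)%E; first by exists pi.
rewrite EFinM -piM -integral_cst//; apply: ae_ge0_le_integral => //.
- by move=> z _; rewrite lee_fin powR_ge0.
- exact: measurable_cost_powR.
- by move=> z _; rewrite lee_fin powR_ge0.
exists [set z | s < cost z]; split=> //; first exact: measurable_cost_gt.
move=> z /=; apply: contra_notP => /negP; rewrite -leNgt => zs _.
rewrite lee_fin; apply: ge0_ler_powR => //; first exact: ltW.
by rewrite nnegrE; have [] := normN.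
Qed.

(** Markov's inequality for the [p]-th power of the cost, uniformly over couplings. *)
Lemma Wp_ge (t p eta : R) : 0 <= t -> 0 < p -> 0 < eta -> (eta%:E <= excess t)%E ->
  ((eta `^ p^-1 * t)%:E <= W p)%E.
Proof.
move=> t0 p0 eta0 etat.
have -> : (eta `^ p^-1 * t)%:E = (((t `^ p * eta)%:E) `^ p^-1)%E.
  by rewrite poweR_EFin powRM ?powR_ge0 ?ltW// -powRrM mulfV ?gt_eqF// powRr1// mulrC.
have le : ((t `^ p * eta)%:E <= ereal_inf [set (\int[pi]_z ((cost z) `^ p)%:E)%E
     | pi in coupling mu nu])%E.
  apply: le_ereal_inf_tmp => _ [pi cpi <-].
  have := measurable_cost_gt _ _ _ normN t; set A := [set z | _] => mA.
  apply: (@le_trans _ _ (\int[pi]_(z in A) ((cost z) `^ p)%:E)%E); last first.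
    apply: ge0_subset_integral => //; first exact: measurable_cost_powR.
    by move=> z _; rewrite lee_fin powR_ge0.
  apply: (@le_trans _ _ (\int[pi]_(z in A) (t `^ p)%:E)%E).
    rewrite integral_cst// EFinM lee_wpmul2l ?lee_fin ?powR_ge0//.
    by apply: le_trans etat _; apply: ereal_inf_lbound; exists pi.
  apply: ge0_le_integral => //.
  - by move=> z _; rewrite lee_fin powR_ge0.
  - by apply: measurable_funTS; exact: measurable_cost_powR.
  - move=> z /= tz; rewrite lee_fin; apply: ge0_ler_powR; [exact: ltW|by []| |exact: ltW].
    by rewrite nnegrE; have [] := normN.
apply: gt0_ler_poweR => //; first by rewrite invr_ge0 ltW.
- by rewrite in_itv/= leey andbT lee_fin mulr_ge0 ?powR_ge0// ltW.
rewrite in_itv/= leey andbT; apply: le_trans le.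
by rewrite lee_fin mulr_ge0 ?powR_ge0// ltW.
Qed.

Lemma excess_ge0 t : (0 <= excess t)%E.
Proof. by apply: le_ereal_inf_tmp => _ [pi _ <-]. Qed.

Lemma excess_le s t : s <= t -> (excess t <= excess s)%E.
Proof.
move=> st; apply: le_ereal_inf_tmp => _ [pi cpi <-].
apply: ge_ereal_inf; exists (pi [set z | t < cost z]); first by exists pi.
apply: le_measure; rewrite ?inE; [exact: measurable_cost_gt..|].
by move=> z /=; exact: le_lt_trans.
Qed.

Lemma near_Wp_ge (t a : R) : 0 <= t -> excess t != 0%E -> a < t ->
  \forall p \near +oo, (a%:E <= W p)%E.
Proof.
move=> t0 et at_.
have [eta eta0 etat] : exists2 eta : R, 0 < eta & (eta%:E <= excess t)%E.
  have : (0 < excess t)%E by rewrite lt_neqAle eq_sym et excess_ge0.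
  case: (excess t) => [r|_|//]; first by rewrite lte_fin => r0; exists r.
  (* The excess is [+oo] when there is no coupling; any positive [eta] then serves. *)
  by exists 1 => //; rewrite leey.
have : eta `^ p^-1 * t @[p --> +oo] --> (1 * t : R).
  by apply: cvgMr_tmp; exact: powR_inv_cvg1.
rewrite mul1r => /cvgr_gt /(_ _ at_) H.
have p_gt0 : \forall p \near +oo, (0 : R) < p by exact: nbhs_pinfty_gt.
near=> p; apply: (@le_trans _ _ (eta `^ p^-1 * t)%:E).
  by rewrite lee_fin ltW//; near: p.
by apply: Wp_ge => //; near: p.
Unshelve. all: by end_near. Qed.

(** The condition [0 <= t] keeps the infimum nonnegative even for zero mass, where the excess may
    vanish at negative [t] too. *)
Definition crit : \bar R :=
  ereal_inf [set t%:E | t in [set t | 0 <= t /\ excess t = 0%E]].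

Lemma Wp_cvg_crit : (mu setT < +oo)%E -> (nu setT < +oo)%E ->
  W p @[p --> +oo] --> crit.
Proof.
move=> mufin nufin.
have lower (a : R) : (a%:E < crit)%E -> \forall p \near +oo, (a%:E <= W p)%E.
  move=> ac; have [a0|a0] := ltP a 0.
    apply: nearW => p; apply: (@le_trans _ _ 0%E); first by rewrite lee_fin ltW.
    exact: poweR_ge0.
  (* A nonnegative [t] below [crit] has nonzero excess; the room between [a] and [t] pays for the
     factor [eta ^ (1/p)], which only tends to 1. *)
  have [t] : exists2 t : R, a < t & (t%:E < crit)%E.
    move: ac; case: crit => [c|_|//].
      by rewrite lte_fin => ac; exists ((a + c) / 2); rewrite ?lte_fin; lra.
    by exists (a + 1); rewrite ?ltry// ltrDl.
  move=> at_ tc; apply: (near_Wp_ge _ _ _ _ at_); first exact: le_trans (ltW at_).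
  apply: contraTneq tc => et; rewrite -leNgt; apply: ereal_inf_lbound.
  by exists t => //; split=> //; exact: le_trans (ltW at_).
have : (0 <= crit)%E.
  by apply: le_ereal_inf_tmp => _ [t [t0 _] <-]; rewrite lee_fin.
case cE : crit lower => [s| |//] lower s0; last first.
  by apply/cvgeyPge => a; apply: lower; rewrite ltry.
rewrite lee_fin in s0.
have [|pi cpi pi0] := excess_attained _ _ N mu nu normN mufin nufin s.
  move=> t st; have : (crit < t%:E)%E by rewrite cE lte_fin.
  move=> /ereal_inf_lt [_ [u [u0 eu] <-]]; rewrite lte_fin => ut.
  by apply/eqP; rewrite eq_le excess_ge0 andbT -eu; apply: excess_le; exact: ltW.
have upper (b : R) : s < b -> \forall p \near +oo, (W p <= b%:E)%E.
  (* The mass [M] may be 0, while the limit of [p]-th roots being 1 requires a positive base, hence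
     the maximum with 1. *)
  move=> sb; pose M := fine (mu setT); pose K := Num.max M 1.
  have K0 : 0 < K by rewrite lt_max ltr01 orbT.
  have : K `^ p^-1 * s @[p --> +oo] --> (1 * s : R).
    by apply: cvgMr_tmp; exact: powR_inv_cvg1.
  rewrite mul1r => /cvgr_lt /(_ _ sb) H.
  have p_gt0 : \forall p \near +oo, (0 : R) < p by exact: nbhs_pinfty_gt.
  near=> p; have p0 : 0 < p by near: p.
  apply: (@le_trans _ _ (M `^ p^-1 * s)%:E).
    by apply: (Wp_le pi) => //; rewrite /M fineK// ge0_fin_numE.
  apply: (@le_trans _ _ (K `^ p^-1 * s)%:E); last by rewrite lee_fin ltW//; near: p.
  rewrite lee_fin ler_wpM2r//; apply: ge0_ler_powR; rewrite ?nnegrE ?invr_ge0 ?(ltW p0)//.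
  - by rewrite fine_ge0.
  - exact: ltW.
  - by rewrite /K le_max lexx.
have Wfin : \forall p \near +oo, W p \is a fin_num.
  have := upper (s + 1); rewrite ltrDl => /(_ ltr01); apply: filterS => p Wp1.
  by rewrite ge0_fin_numE ?poweR_ge0//; exact: le_lt_trans Wp1 (ltry _).
apply/fine_cvgP; split=> //; apply/cvgrPdist_le => e e0.
have up := upper (s + e); rewrite ltrDl in up.
have lo := lower (s - e); rewrite lte_fin gtrBl in lo.
move: (lo e0) (up e0) => lo' up'.
near=> p; have Wf : W p \is a fin_num by near: p.
have : (((s - e)%R)%:E <= W p)%E by near: p.
have : (W p <= ((s + e)%R)%:E)%E by near: p.
rewrite /= -(fineK Wf) !lee_fin => h1 h2.
rewrite ler_distl; apply/andP; split; lra.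
Unshelve. all: by end_near. Qed.

End wasserstein.

(** * Comparison of the critical distance with [2 * eps] *)

Theorem theorem5 (R : realType) (d : nat) (N : d.-tuple R -> R) (eps : R)
    (mu nu : {measure set (d.-tuple R) -> \bar R}) :
  is_norm N -> 0 <= eps ->
  (mu setT < +oo)%E -> (nu setT < +oo)%E -> mu setT = nu setT ->
  abs_cont_leb mu -> abs_cont_leb nu ->
  bounded_support N mu -> bounded_support N nu ->
  Deps N mu nu eps = 0%E <-> (Winf N mu nu <= (2 * eps)%:E)%E.
Proof.
move=> normN eps0 mufin nufin _ _ _ _ _.
have eps20 : 0 <= 2 * eps by rewrite mulr_ge0.
have -> : Winf N mu nu = crit R d N mu nu.
  by apply/cvg_lim => //; exact: Wp_cvg_crit.
rewrite -[Deps N mu nu eps]/(excess R d N mu nu (2 * eps)); split=> [e0|critle].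
  by apply: ereal_inf_lbound; exists (2 * eps).
(* The bound on [crit] makes the excess vanish only strictly above [2 * eps]; attainment carries
   this to [2 * eps] itself. *)
have [t st|pi cpi pi0] := excess_attained R d N mu nu normN mufin nufin (2 * eps).
  have /ereal_inf_lt[_ [u [u0 eu] <-]] : (crit R d N mu nu < t%:E)%E.
    by apply: le_lt_trans critle _; rewrite lte_fin.
  rewrite lte_fin => ut; apply/eqP; rewrite eq_le excess_ge0 andbT -eu.
  by apply: excess_le => //; exact: ltW.
apply/eqP; rewrite eq_le excess_ge0 andbT -pi0.
by apply: ereal_inf_lbound; exists pi.
Qed.
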